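(* Let $\mathcal{F},\mathcal{G}$ be regular thin families. If $o(\mathcal{F})<o(\mathcal{G})$, then for every map $\varphi:\mathcal{F}\to\mathcal{G}$ and every infinite $M\subseteq\mathbb{N}$ there exists an infinite $L\subseteq M$ such that for every plegma pair $(s_1,s_2)$ of elements of $\mathcal{F}\upharpoonright L$, neither $(\varphi(s_1),\varphi(s_2))$ nor $(\varphi(s_2),\varphi(s_1))$ is a plegma pair.
   Context: $\mathbb{N}=\{1,2,\dots\}$. For a finite set $s\subset\mathbb{N}$, $|s|$ is its cardinality and $s(k)$ its $k$-th element in increasing order; $t\sqsubseteq s$ means that $t$ is an initial segment of $s$. For a family $\mathcal{F}$ of finite subsets of $\mathbb{N}$ let $\widehat{\mathcal{F}}=\{t:\exists s\in\mathcal{F},\ t\sqsubseteq s\}$ and $\mathcal{F}\upharpoonright L=\{s\in\mathcal{F}:s\subseteq L\}$. $\mathcal{F}$ is thin if no element is a proper initial segment of another. A family is regular if it is hereditary (closed under subsets), spreading (if $\{n_1<\dots<n_k\}$ is in it, $m_1<\dots<m_k$, $n_i\le m_i$ for all $i$, then $\{m_1,\dots,m_k\}$ is in it) and compact (its characteristic functions form a closed subset of $\{0,1\}^{\mathbb{N}}$). $\mathcal{F}$ is regular thin if it is thin and $\widehat{\mathcal{F}}$ is regular. The order $o(\mathcal{F})$ of a nonempty regular thin family is the (countable) rank of the well-founded tree $\widehat{\mathcal{F}}$: maximal elements of $\widehat{\mathcal{F}}$ have rank $0$, the rank of $s$ is $\sup\{\mathrm{rank}(t)+1: t\in\widehat{\mathcal{F}},\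 s\sqsubset t\}$, and $o(\mathcal{F})$ is the rank of $\emptyset$; by convention $o(\emptyset)=-1$. A tuple $(s_1,\dots,s_l)$ of nonempty finite subsets of $\mathbb{N}$ is plegma if (i) $s_i(k)<s_j(k)$ whenever $1\le i<j\le l$ and $k\le\min(|s_i|,|s_j|)$, and (ii) $s_i(k)<s_j(k+1)$ for all $i,j\in\{1,\dots,l\}$ and $k\le\min(|s_i|,|s_j|-1)$. A plegma pair is a plegma tuple with $l=2$. *)

(* Defs.v *)
From mathcomp Require Import all_boot finmap.
From mathcomp Require Import all_classical topology cantor.

Set Implicit Arguments.
Unset Strict Implicit.
Unset Printing Implicit Defensive.

Local Open Scope classical_set_scope.

(* The natural numbers are {1, 2, ...}: a finite set of natural numbers is an
   [s : {fset nat}] with [[set` s] `<=` posN]. *)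
Definition posN : set nat := [set n | 0 < n].

Definition family_on (L : set nat) (F : set {fset nat}) : Prop :=
  forall s, F s -> [set` s] `<=` L.

Definition family_restrict (F : set {fset nat}) (L : set nat) : set {fset nat} :=
  [set s | F s /\ [set` s] `<=` L].

Definition increasing_seq (s : {fset nat}) : seq nat := sort leq s.

(* [elt s k] is s(k), with k = 1, ..., |s| *)
Definition elt (s : {fset nat}) (k : nat) : nat := nth 0 (increasing_seq s) k.-1.

Definition initial_segment (t s : {fset nat}) : bool :=
  prefix (increasing_seq t) (increasing_seq s).

Definition proper_initial_segment (t s : {fset nat}) : bool :=
  initial_segment t s && (t != s).

Definition hat (F : set {fset nat}) : set {fset nat} :=
  [set t | exists2 s, F s & initial_segment t s].

Definition thin_family (F : set {fset nat}) : Prop :=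
  forall s t, F s -> F t -> ~~ proper_initial_segment t s.

Definition hereditary (F : set {fset nat}) : Prop :=
  forall s t : {fset nat}, F s -> (t `<=` s)%fset -> F t.

Definition spreading (F : set {fset nat}) : Prop :=
  forall s t : {fset nat}, F s -> #|` t| = #|` s| ->
    (forall k, 0 < k <= #|` s| -> elt s k <= elt t k) -> F t.

(* For s a subset of posN the coordinate 0 is constantly [false], which
   identifies {0,1}^posN with a closed subspace of [cantor_space]. *)
Definition char_fun (s : {fset nat}) : cantor_space := fun n => n \in s.

Definition compact_family (F : set {fset nat}) : Prop :=
  closed (char_fun @` F).

Definition regular_family (F : set {fset nat}) : Prop :=
  [/\ hereditary F, spreading F & compact_family F].

Definition regular_thin (F : set {fset nat}) : Prop :=
  thin_family F /\ regular_family (hat F).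

(* Ordinals as well-founded trees: [OSup f] is the least ordinal above all [f a].
   Distinct trees may denote the same ordinal; [ole] and [olt] compare the ordinals. *)
Inductive ord : Type := OSup (A : Type) (f : A -> ord).

Fixpoint ole (a b : ord) {struct a} : Prop :=
  match a, b with
  | OSup A f, OSup B g => forall i : A, exists j : B, ole (f i) (g j)
  end.

Definition olt (a b : ord) : Prop :=
  match b with OSup B g => exists j : B, ole a (g j) end.

Definition extends (T : set {fset nat}) (t s : {fset nat}) : Prop :=
  T t /\ proper_initial_segment s t.

Fixpoint tree_rank (T : set {fset nat}) (s : {fset nat})
    (a : Acc (extends T) s) {struct a} : ord :=
  OSup (fun t : {t | extends T t s} => tree_rank (Acc_inv a (proj2_sig t))).

Lemma mem_increasing_seq s : increasing_seq s =i s.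
Proof. by move=> n; rewrite mem_sort. Qed.

Lemma initial_sub t s : initial_segment t s -> {subset t <= s}.
Proof.
move=> /prefixP[r e] n; rewrite -(mem_increasing_seq t) -(mem_increasing_seq s) e.
by rewrite mem_cat => ->.
Qed.

Lemma proper_initial_lt t s : proper_initial_segment t s -> #|` t| < #|` s|.
Proof.
case/andP=> ts nts; rewrite ltnNge; apply: contra nts => st.
have ss : (t `<=` s)%fset by apply/fsubsetP; exact: initial_sub.
by rewrite eqEfcard ss.
Qed.

Lemma extends_wf (T : set {fset nat}) :
  compact_family T -> well_founded (extends T).
Proof.
move=> cT s0; apply: contrapT => nA0.
pose R (x y : {s | ~ Acc (extends T) s}) := extends T (sval y) (sval x).
have [x|f [f0 fS]] := @dependent_choice _ R _ (exist _ s0 nA0).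
  apply: cid; apply: contrapT => h; apply: (svalP x); constructor => y ey.
  by apply: contrapT => nAy; apply: h; exists (exist _ y nAy).
pose u n := sval (f n).
have uS n : extends T (u n.+1) (u n) by exact: fS.
have mono m n : m <= n -> {subset u m <= u n}.
  move=> /subnK <-; elim: (n - m) => [//|k IH] x /IH.
  by apply: initial_sub; case/andP: (uS (k + m)).2.
have big n : n <= #|` u n|.
  elim: n => // n IH; apply: leq_ltn_trans IH _.
  by apply: proper_initial_lt; exact: (uS n).2.
pose l : cantor_space := fun n => `[< exists k, n \in u k >].
suff : (char_fun @` T) l.
  case=> s Ts sl; have us k : (u k `<=` s)%fset.
    apply/fsubsetP => n nk; have : char_fun s n = l n by rewrite sl.
    by rewrite /char_fun => ->; apply/asboolP; exists k.
  have := leq_trans (big #|` s|.+1) (fsubset_leq_card (us _)).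
  by rewrite ltnn.
apply: (@closed_cvg _ cantor_space \oo _ (char_fun \o u) _ cT).
  exists 1%N => // -[//|n] _ /=; exists (u n.+1) => //; exact: (uS n).1.
apply/cvg_sup => i U [V] [[W] oW <-] Wl WU; apply: (filterS WU).
have [k lk] : exists k, forall n, k <= n -> (i \in u n) = l i.
  rewrite /l; case: asboolP => [[k ik]|h].
    by exists k => n kn; apply: (mono _ _ kn).
  by exists 0 => n _; apply/negbTE/negP => iu; apply: h; exists n.
by exists k => // n /= kn; rewrite /char_fun lk.
Qed.

(* The order of the empty family is -1, represented by [None] *)
Definition family_order (F : set {fset nat}) (rF : regular_thin F) : option ord :=
  let: conj _ (And3 _ _ cF) := rF in
  if pselect (F = set0) then None
  else Some (tree_rank (extends_wf cF fset0)).

Definition order_lt (a b : option ord) : Prop :=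
  match a, b with
  | Some a, Some b => olt a b
  | None, Some _ => True
  | _, None => False
  end.

Definition plegma (l : nat) (s : l.-tuple {fset nat}) : Prop :=
  [/\ forall i : 'I_l, tnth s i != fset0,
      forall (i j : 'I_l) (k : nat), i < j ->
        0 < k <= minn #|` tnth s i| #|` tnth s j| ->
        elt (tnth s i) k < elt (tnth s j) k
    & forall (i j : 'I_l) (k : nat),
        0 < k <= minn #|` tnth s i| (#|` tnth s j| - 1) ->
        elt (tnth s i) k < elt (tnth s j) k.+1].

Definition plegma_pair (s t : {fset nat}) : Prop := plegma [tuple s; t].

(* Main.v *)
Require Import Defs.
From mathcomp Require Import all_boot finmap all_classical.
From mathcomp Require Import zify.

(* Finite sets are handled as initial segments of increasing sequences. On a
   suitable [e], every infinite [k] determines the element [f k] of [G] that is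
   the image of the initial segment of [e o k] in [F], and by Ramsey's theorem
   for clopen colourings either no plegma pair has a plegma image (in a given
   order), or all of them do. If all images are reversed, the minima decrease
   forever along an infinite plegma path. If all are preserved, plegma paths
   give [k(j) - j <= (f k)(j)] as long as [j < |f k|], when [k] has no two
   consecutive values. As [o(F) < o(G)], some such [k] has [|f k| > d], where
   [d] is the length of the initial segment of [e o k] in [F]; but [f k] does
   not depend on [k(d)], which can be made arbitrarily large. *)

Set Implicit Arguments.
Unset Strict Implicit.
Unset Printing Implicit Defensive.

Local Open Scope classical_set_scope.

(** * Infinite sets as increasing sequences *)

Definition increasing (x : nat -> nat) := {homo x : i j / i < j}.

Lemma increasingS x : (forall i, x i < x i.+1) -> increasing x.
Proof. by apply: homo_ltn => a b c; apply: ltn_trans. Qed.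

Lemma increasing_ge x i : increasing x -> i <= x i.
Proof. by move=> ix; elim: i => // i /leq_ltn_trans; apply; apply: ix. Qed.

Lemma increasing_leq x i j : increasing x -> i <= j -> x i <= x j.
Proof. by move=> ix; rewrite leq_eqVlt => /predU1P[->//|/ix/ltnW]. Qed.

Lemma increasing_ltn x i j : increasing x -> (x i < x j) = (i < j).
Proof.
move=> ix; case: (ltnP i j) => [/ix//|ji].
by rewrite ltnNge increasing_leq.
Qed.

Lemma increasing_comp x y : increasing x -> increasing y -> increasing (x \o y).
Proof. by move=> ix iy i j /iy/ix. Qed.

(** Inclusion of infinite sets, each given by its increasing enumeration. *)
Definition refines (x e : nat -> nat) : Prop :=
  increasing x /\ forall i, exists j, x i = e j.

Lemma refines_refl e : increasing e -> refines e e.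
Proof. by split=> // i; exists i. Qed.

Lemma refines_comp e k : increasing e -> increasing k -> refines (e \o k) e.
Proof. by move=> ie ik; split=> [|i]; [exact: increasing_comp|exists (k i)]. Qed.

Lemma refines_trans y x z : refines x y -> refines y z -> refines x z.
Proof.
move=> [ix xy] [_ yz]; split=> // i; have [j ->] := xy i; exact: yz.
Qed.

(** * Ramsey's theorem for clopen colourings *)

Definition scons (n : nat) (x : nat -> nat) : nat -> nat :=
  fun i => if i is j.+1 then x j else n.

(** A colouring decided by finitely many entries, presented as a well-founded decision tree on which
    induction is possible. *)
Inductive clopen : ((nat -> nat) -> Prop) -> Prop :=
| clopen_const P (b : Prop) : (forall x, P x <-> b) -> clopen P
| clopen_branch P : (forall n, clopen (P \o scons n)) -> clopen P.

Definition homogeneous (P : (nat -> nat) -> Prop) (e : nat -> nat) : Prop :=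
  (forall x, refines x e -> P x) \/ (forall x, refines x e -> ~ P x).

Lemma unbounded_subsequence (B : nat -> Prop) :
  (forall n, exists2 m, n <= m & B m) ->
  exists2 r, increasing r & forall i, B (r i).
Proof.
move=> h; have /choice[g gP] n : exists m, n <= m /\ B m.
  by have [m] := h n; exists m.
exists (fun i => iter i (g \o S) (g 0)) => [|[|i]].
- by apply: increasingS => i /=; apply: (gP _).1.
- exact: (gP 0).2.
- exact: (gP _).2.
Qed.

(** Induction on the decision tree. At a branch, a fusion sequence settles the colour for each
    possible first entry, and the pigeonhole principle then makes this colour the same for all of
    them. *)
Lemma clopen_ramsey P e : clopen P -> increasing e ->
  exists2 e', refines e' e & homogeneous P e'.
Proof.
move=> cP; elim: cP e => {P} [P b Pb|P _ IH] e ie.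
  exists e; first exact: refines_refl.
  by have [hb|hb] := pselect b; [left|right] => x _; rewrite Pb.
have /choice[g gP] (f : nat -> nat) : exists f', increasing f ->
    refines f' (f \o S) /\ homogeneous (P \o scons (f 0)) f'.
  have [jf|nf] := pselect (increasing f); last by exists f.
  have [|f' f1 f2] := IH (f 0) (f \o S); last by exists f'.
  by apply: increasing_comp => // i j.
(* [E i.+1] refines the tail of [E i] and is homogeneous once the first entry is [d i]; [d] is the
   diagonal of the fusion. *)
pose E i := iter i g e; pose d i := E i 0.
have iE i : increasing (E i).
  by elim: i => // i /gP[[]].
have ES i : refines (E i.+1) (E i \o S) by have [] := gP _ (iE i).
have Eh i : homogeneous (P \o scons (d i)) (E i.+1) by have [] := gP _ (iE i).
have EE i n : refines (E (n + i)) (E i).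
  elim: n => [|n IHn]; first exact: refines_refl.
  apply: refines_trans IHn; apply: refines_trans (ES _) _.
  by apply: refines_comp => // a b.
have id : increasing d.
  apply: increasingS => i; have [_ /(_ 0)[j dj]] := ES i.
  by rewrite /d dj; apply: iE.
have de : refines d e.
  split=> // i; have [_ /(_ 0)] := EE 0 i; by rewrite addn0.
have tail x i : refines x d -> x 0 = d i -> refines (x \o S) (E i.+1).
  move=> [ix xd] x0; split=> [|j]; first by apply: increasing_comp => // a b.
  have [m xm] := xd j.+1; have im : i < m.
    by rewrite -(increasing_ltn _ _ id) -x0 -xm; apply: ix.
  by rewrite /= xm /d -(subnK im); apply: (EE _ _).2.
have xE (x : nat -> nat) : x = scons (x 0) (x \o S) by apply/funext => -[].
pose B i := forall y, refines y (E i.+1) -> P (scons (d i) y).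
(* Infinitely many first entries of positive colour give a positive subsequence; otherwise the
   colour is negative from some index on. *)
have [hB|] := pselect (forall n, exists2 m, n <= m & B m).
  have [r ir Br] := unbounded_subsequence hB.
  exists (d \o r); first by apply: refines_trans de; apply: refines_comp.
  left=> x xdr; have xd : refines x d.
    by apply: refines_trans xdr _; apply: refines_comp.
  by have [i /= x0] := xdr.2 0; rewrite (xE x) x0; apply: Br; apply: tail.
move=> /existsNP[n nB]; have ia : increasing (addn n) by move=> i j; rewrite ltn_add2l.
exists (d \o addn n); first by apply: refines_trans de; apply: refines_comp.
right=> x xdr; have xd : refines x d.
  by apply: refines_trans xdr _; apply: refines_comp.
have [i /= x0] := xdr.2 0; rewrite (xE x) x0.
have [hb|] := Eh (n + i); last by apply; apply: tail.
by case: nB; exists (n + i); first exact: leq_addr.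
Qed.

Definition continuous_on_increasing (P : (nat -> nat) -> Prop) : Prop :=
  forall x, increasing x -> exists n, forall y, increasing y ->
    (forall i, i < n -> y i = x i) -> (P y <-> P x).

(* A retraction of all sequences onto the increasing ones, which extends
   colourings of increasing sequences to the whole Baire space. *)
Fixpoint climb (x : nat -> nat) (i : nat) : nat :=
  if i is j.+1 then maxn (x j.+1) (climb x j).+1 else x 0.

Lemma climb_increasing x : increasing (climb x).
Proof. by apply: increasingS => i /=; rewrite leq_maxr. Qed.

Lemma climb_id x : increasing x -> climb x = x.
Proof.
move=> ix; apply/funext; elim=> //= i ->; apply/maxn_idPl; exact: ix.
Qed.

Lemma climb_local x y n : (forall i, i < n -> y i = x i) ->
  forall i, i < n -> climb y i = climb x i.
Proof.
move=> yx; elim=> [|i IH] /= h; first exact: yx.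
by rewrite yx // IH // ltnW.
Qed.

(** A colouring without a decision tree still has none after a suitable first entry is fixed, hence
    all along some branch [x]. Continuity at [climb x] makes it constant beyond a finite part of
    this branch. *)
Lemma continuous_clopen P :
  continuous_on_increasing P -> clopen (P \o climb).
Proof.
move=> cP; apply: contrapT => nC.
pose app (s : seq nat) y := foldr scons y s.
have /choice[g gP] s : exists n, ~ clopen (P \o climb \o app s) ->
    ~ clopen (P \o climb \o app (rcons s n)).
  have [hs|hs] := pselect (clopen (P \o climb \o app s)); first by exists 0.
  have [n hn] : exists n, ~ clopen (P \o climb \o app s \o scons n).
    by apply/existsNP => h; apply: hs; apply: clopen_branch.
  exists n => _; suff -> : app (rcons s n) = app s \o scons n by [].
  by apply/funext => y; rewrite /app foldr_rcons.
pose s i := iter i (fun s => rcons s (g s)) [::]; pose x i := g (s i).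
have sE i : s i = mkseq x i.
  by elim: i => // i IH; rewrite mkseqS /s iterS -/(s i) IH /x IH.
have nCs i : ~ clopen (P \o climb \o app (s i)).
  by elim: i => // i; apply: gP.
have [n nP] := cP _ (climb_increasing x).
apply: (nCs n); apply: (@clopen_const _ (P (climb x))) => y.
apply: nP; first exact: climb_increasing.
apply: climb_local => i; rewrite sE => lt_in.
have appE (t : seq nat) j : j < size t -> app t y j = nth 0 t j.
  by elim: t j => // a t IH [|j] //= /IH.
by rewrite /= appE ?size_mkseq // nth_mkseq.
Qed.

Theorem ramsey P e : continuous_on_increasing P -> increasing e ->
  exists2 e', refines e' e & homogeneous P e'.
Proof.
move=> /continuous_clopen cP /(clopen_ramsey cP)[e' e'e hom]; exists e' => //.
by case: hom => h; [left|right] => x xe; have /= := h x xe; rewrite climb_id //; apply: xe.1.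
Qed.

(** * Finite sets as initial segments of sequences *)

Definition pre (x : nat -> nat) (n : nat) : {fset nat} := [fset k in mkseq x n]%fset.

Lemma increasing_seq_pre x n : increasing x -> increasing_seq (pre x n) = mkseq x n.
Proof.
move=> ix; have sx : sorted ltn (mkseq x n).
  apply: (homo_sorted (e := ltn)); last exact: iota_ltn_sorted.
  exact: ix.
have ux : uniq (mkseq x n) by apply: sorted_uniq sx; [exact: ltn_trans|exact: ltnn].
apply: (sorted_eq leq_trans anti_leq).
- by apply: sort_sorted; apply: leq_total.
- by move: sx; rewrite ltn_sorted_uniq_leq => /andP[].
- apply: uniq_perm; rewrite ?sort_uniq ?fset_uniq // => k.
  by rewrite mem_increasing_seq in_fset.
Qed.

Lemma mem_pre x n k : (k \in pre x n) = (k \in mkseq x n).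
Proof. by rewrite in_fset. Qed.

Lemma pre0 x : pre x 0 = fset0.
Proof. by apply/fsetP => k; rewrite mem_pre inE. Qed.

Lemma card_pre x n : increasing x -> #|` pre x n| = n.
Proof.
by move=> ix; rewrite -(size_sort leq) -/(increasing_seq _) increasing_seq_pre // size_mkseq.
Qed.

Lemma elt_pre x n k : increasing x -> 0 < k <= n -> elt (pre x n) k = x k.-1.
Proof.
by case: k => // k ix kn; rewrite /elt increasing_seq_pre // nth_mkseq.
Qed.

Lemma eq_pre x y n : (forall i, i < n -> x i = y i) -> pre x n = pre y n.
Proof.
move=> xy; apply/fsetP => k; rewrite !mem_pre; congr (k \in _).
by apply/eq_in_map => i; rewrite mem_iota; apply: xy.
Qed.

Lemma initial_pre x m n : increasing x -> m <= n -> initial_segment (pre x m) (pre x n).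
Proof.
move=> ix mn; rewrite /initial_segment !increasing_seq_pre //.
by rewrite -(subnKC mn) /mkseq iotaD map_cat prefix_prefix.
Qed.

Lemma increasing_seq_inj : injective increasing_seq.
Proof.
by move=> s t st; apply/fsetP => k; rewrite -!mem_increasing_seq st.
Qed.

Lemma initial_preE x n s : increasing x -> initial_segment s (pre x n) ->
  #|` s| <= n /\ s = pre x #|` s|.
Proof.
move=> ix sx; have sn : #|` s| <= n.
  by rewrite -(card_pre n ix); apply/fsubset_leq_card/fsubsetP/initial_sub.
split=> //; apply: increasing_seq_inj; rewrite increasing_seq_pre //.
have := sx; rewrite /initial_segment prefixE => /eqP <-.
rewrite increasing_seq_pre // size_sort /mkseq -map_take take_iota.
by move/minn_idPl: sn => ->.
Qed.

Lemma proper_pre x m n : increasing x -> m < n -> proper_initial_segment (pre x m) (pre x n).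
Proof.
move=> ix mn; rewrite /proper_initial_segment initial_pre ?(ltnW mn) //=.
by apply/eqP => /(congr1 (fun s : {fset nat} => #|` s|)); rewrite !card_pre //; lia.
Qed.

(** As an increasing [e] satisfies [i <= e i], the shift by [N + x n.-1] puts the tail above [N] and
    above the last kept entry. For [n = 0] it only moves the tail further. *)
Definition splice (x : nat -> nat) (n : nat) (e : nat -> nat) (N : nat) : nat -> nat :=
  fun i => if i < n then x i else e (i + N + x n.-1).+1.

Lemma splice_ge x n e N : increasing e -> N <= splice x n e N n.
Proof.
by rewrite /splice ltnn => /increasing_ge ge; apply: leq_trans (ge _); lia.
Qed.

Lemma splice_lt x n e N i : i < n -> splice x n e N i = x i.
Proof. by rewrite /splice => ->. Qed.

Lemma splice_refines x n e N : increasing e ->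
  (forall i j, i < j < n -> x i < x j) ->
  (forall i, i < n -> exists j, x i = e j) -> refines (splice x n e N) e.
Proof.
move=> ie ix xe; split=> [|i]; last first.
  by rewrite /splice; case: ifP => [/xe//|_]; exists (i + N + x n.-1).+1.
apply: increasingS => i; rewrite /splice; case: (ltnP i n) => i_n; last first.
  by rewrite ifF; [apply: ie; lia|lia].
case: (ltnP i.+1 n) => Si; first by apply: ix; rewrite ltnSn.
have -> : n = i.+1 by lia.
by apply: leq_trans (increasing_ge _ ie); rewrite /=; lia.
Qed.

Lemma splice_pre x n e N : pre (splice x n e N) n = pre x n.
Proof. by apply: eq_pre => i; apply: splice_lt. Qed.

Lemma fset_pre (e : nat -> nat) (s : {fset nat}) : increasing e ->
  (forall k, k \in s -> exists j, k = e j) ->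
  exists2 x, refines x e & s = pre x #|` s|.
Proof.
move=> ie se; pose x i := nth 0 (increasing_seq s) i.
have ss : sorted ltn (increasing_seq s).
  by rewrite ltn_sorted_uniq_leq sort_uniq fset_uniq sort_sorted //; apply: leq_total.
have sz : size (increasing_seq s) = #|` s| by rewrite size_sort.
exists (splice x #|` s| e 0).
  apply: splice_refines => // [i j /andP[ij js]|i i_s].
    by apply: (sorted_ltn_nth ltn_trans) => //; rewrite inE sz //; apply: ltn_trans js.
  by apply: se; rewrite -mem_increasing_seq mem_nth ?sz.
apply/fsetP => k; rewrite splice_pre mem_pre -mem_increasing_seq -sz.
by rewrite mkseq_nth.
Qed.

Lemma fset_preT (s : {fset nat}) : exists2 x, increasing x & s = pre x #|` s|.
Proof.
have [//|k _|x [ix _] sx] := @fset_pre id s; first by exists k.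
by exists x.
Qed.

(** * Regular thin families *)

Section RegularThin.
Variables (F : set {fset nat}) (rF : regular_thin F).

Lemma hat_pre_le x m n : increasing x -> m <= n -> hat F (pre x n) -> hat F (pre x m).
Proof.
move=> ix mn xF; have [_ [her _ _]] := rF; apply: her xF _.
by apply/fsubsetP/initial_sub/initial_pre.
Qed.

Lemma hat_spread x y n : increasing x -> increasing y ->
  (forall i, i < n -> x i <= y i) -> hat F (pre x n) -> hat F (pre y n).
Proof.
move=> ix iy xy xF; have [_ [_ spr _]] := rF; apply: spr xF _ _; rewrite !card_pre //.
by move=> k kn; rewrite !elt_pre //; apply: xy; lia.
Qed.

Lemma sub_hat s : F s -> hat F s.
Proof. by move=> Fs; exists s => //; apply: prefix_refl. Qed.

(** Otherwise the sets [pre x n] would form an infinite branch of the well-founded tree [hat F]. *)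
Lemma hat_bounded x : increasing x -> exists n, ~ hat F (pre x n).
Proof.
move=> ix; apply/existsNP => all_hat; have [_ [_ _ cF]] := rF.
suff : forall s, Acc (extends (hat F)) s -> forall n, s <> pre x n.
  by move/(_ _ (extends_wf cF (pre x 0)))/(_ 0).
move=> s; elim=> {}s _ IH n sx; apply: (IH (pre x n.+1) _ n.+1) => //.
by rewrite sx; split; [exact: all_hat|exact: proper_pre].
Qed.

Lemma thin_pre x m n : increasing x -> F (pre x m) -> hat F (pre x n) -> n <= m.
Proof.
move=> ix Fm [u Fu nu]; rewrite leqNgt; apply/negP => mn; have [thin _] := rF.
apply/negP: (thin _ _ Fu Fm); rewrite negbK.
have [y iy uy] := fset_preT u; rewrite uy in nu *.
have [nu' ny] := initial_preE iy nu; rewrite card_pre // in nu' ny.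
have -> : pre x m = pre y m.
  have mx := initial_pre ix (ltnW mn); rewrite ny in mx.
  by have [_ ->] := initial_preE iy mx; rewrite card_pre.
by apply: proper_pre => //; lia.
Qed.

Lemma thin_pre_eq x m n : increasing x -> F (pre x m) -> F (pre x n) -> m = n.
Proof.
by move=> ix Fm Fn; apply/eqP; rewrite eqn_leq !(thin_pre ix _ (sub_hat _)).
Qed.

(** If [m < n], continue [pre y m] by an entry above [x m]: spreading puts the longer set into
    [hat F], contrary to thinness. *)
Lemma thin_spread x y m n : increasing x -> increasing y -> hat F (pre x n) ->
  F (pre y m) -> (forall i, i < m -> i < n -> x i <= y i) -> n <= m.
Proof.
move=> ix iy xF yF xy; rewrite leqNgt; apply/negP => mn.
have [|i j /andP[ij _]|i _|iz _] := @splice_refines y m id (x m); rewrite //.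
- exact: iy.
- by exists (y i).
set z := splice y m id (x m) in iz.
have zF : F (pre z m) by rewrite splice_pre.
suff /(thin_pre iz zF) : hat F (pre z m.+1) by rewrite ltnn.
apply: (hat_spread ix) (hat_pre_le ix mn xF) => // i.
rewrite ltnS leq_eqVlt => /predU1P[->|im]; first exact: splice_ge.
by rewrite /z splice_lt // xy //; apply: ltn_trans mn.
Qed.

(** Ramsey's theorem applies to the colouring that asks for an initial segment in [F]. The negative
    colour is impossible: by spreading, the empty set can be extended inside any infinite set until
    a member of [F] is reached. *)
Lemma regular_thin_very_large e : F !=set0 -> increasing e ->
  exists2 e', refines e' e & forall x, refines x e' -> exists n, F (pre x n).
Proof.
move=> [s0 Fs0] ie; have [|e' e'e [|none]] := @ramsey (fun x => exists n, F (pre x n)) e _ ie.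
(* No initial segment in [F] is longer than an [n] with [pre x n] outside [hat F], so [n] entries
   decide the colour. *)
- move=> x ix; have [n nF] := hat_bounded ix; exists n => y iy yx.
  split=> -[m mF]; exists m; have mn : m <= n.
  + rewrite leqNgt; apply/negP => /ltnW nm; apply: nF; rewrite -(eq_pre yx).
    exact: hat_pre_le nm (sub_hat mF).
  + by rewrite -(eq_pre (x := y)) // => i im; apply: yx; lia.
  + by rewrite leqNgt; apply/negP => /ltnW nm; apply: nF; apply: hat_pre_le nm (sub_hat mF).
  + by rewrite (eq_pre (y := x)) // => i im; apply: yx; lia.
- by exists e'.
have [ie' _] := e'e; have [_ [_ _ cF]] := rF.
(* Well-founded induction shows that no node of [hat F] lies inside the range of [e']; yet the empty
   set is such a node. *)
suff stuck s : Acc (extends (hat F)) s -> hat F s ->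
    ~ (forall k, k \in s -> exists j, k = e' j).
  case: (stuck fset0); first exact: extends_wf.
  - have [y iy sy] := fset_preT s0; exists s0 => //.
    by rewrite -(pre0 y) sy; apply: initial_pre.
  - by [].
elim=> {}s _ IH [u Fu su] se'; have [x xe' sx] := fset_pre ie' se'.
have [y iy uy] := fset_preT u; rewrite uy in su.
have [sm sy] := initial_preE iy su.
move: sm; rewrite leq_eqVlt => /predU1P[sm|sm].
  by apply: (none x xe'); exists #|` s|; rewrite -sx sy sm -uy.
set n := #|` s| in sx sy sm.
(* The next entry is taken from [e'] above that of [u], so spreading keeps the longer set in
   [hat F]. *)
have [//|i j /andP[ij _]|i _|] := @splice_refines x n e' (y n).
- by apply: xe'.1.
- exact: xe'.2.
set z := splice x n e' (y n) => iz ze'.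
have xy i : i < n -> x i = y i.
  move=> i_n; have := congr1 (elt^~ i.+1) (etrans (esym sx) sy).
  by rewrite !elt_pre //; apply: xe'.1.
have sz : s = pre z n by rewrite splice_pre -sx.
have zF : hat F (pre z n.+1).
  apply: (@hat_spread y) => // [i|].
    rewrite ltnS leq_eqVlt => /predU1P[->|i_n]; first exact: splice_ge.
    by rewrite /z splice_lt // xy.
  by apply: (hat_pre_le iy sm); rewrite -uy; apply: sub_hat.
apply: (IH (pre z n.+1)) => //.
- by split=> //; rewrite sz; apply: proper_pre.
- by move=> k; rewrite mem_pre => /mapP[i _ ->]; apply: ze'.
Qed.

End RegularThin.

(** * Ordinals and ranks of trees *)

Lemma ole_trans b a c : ole a b -> ole b c -> ole a c.
Proof.
elim: a b c => A f IH [B g] [C h] /= ab bc i.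
by have [j fg] := ab i; have [k gh] := bc j; exists k; apply: IH gh.
Qed.

Lemma olt_irrefl a : ~ olt a a.
Proof.
elim: a => A f IH /= [j]; case E: (f j) => [B g] /= fg.
by apply: (IH j); rewrite E; case: (fg j) => k; rewrite E; exists k.
Qed.

Lemma olt_ole_trans b a c : olt a b -> ole b c -> olt a c.
Proof.
case: b c => B g [C h] /= [j aj] bc; have [k gh] := bc j.
by exists k; apply: ole_trans gh.
Qed.

(** Each extension counted in the left rank is sent by [h] to one counted in the right rank. *)
Lemma tree_rank_le (S T : set {fset nat}) (h : {fset nat} -> {fset nat}) :
  (forall s t, extends S t s -> extends T (h t) (h s)) ->
  forall s (a : Acc (extends S) s) (b : Acc (extends T) (h s)),
    ole (tree_rank a) (tree_rank b).
Proof.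
move=> hST s a; elim/Acc_inv_dep: a => {}s r IH [b] /= [t st] /=.
by exists (exist _ (h t) (hST _ _ st)); apply: IH.
Qed.

(** Otherwise taking images under [f] would map the tree [hat G] into [hat F] and preserve proper
    extensions, so that [G] would have at most the order of [F]. *)
Lemma order_lt_hat (F G : set {fset nat}) (rF : regular_thin F) (rG : regular_thin G) f :
  order_lt (family_order rF) (family_order rG) -> F !=set0 -> increasing f ->
  exists x n, [/\ increasing x, hat G (pre x n) & ~ hat F (pre (f \o x) n)].
Proof.
move=> FG [s0 Fs0] jf; apply: contrapT => hn.
have GF x n : increasing x -> hat G (pre x n) -> hat F (pre (f \o x) n).
  by move=> ix Gx; apply: contrapT => nF; apply: hn; exists x, n.
pose h (s : {fset nat}) := [fset f i | i in s]%fset.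
have hpre x n : h (pre x n) = pre (f \o x) n.
  apply/fsetP => k; rewrite mem_pre; apply/imfsetP/mapP => /=.
    by move=> [i]; rewrite mem_pre => /mapP[j jn ->] ->; exists j.
  by move=> [j jn ->]; exists (x j) => //; rewrite mem_pre map_f.
have hext s t : extends (hat G) t s -> extends (hat F) (h t) (h s).
  have [x ix tx] := fset_preT t; rewrite tx => -[Gt st].
  have := proper_initial_lt st; case/andP: st => /(initial_preE ix)[_ sx] _.
  rewrite card_pre // => lt; rewrite sx !hpre; split; first exact: GF.
  by apply: proper_pre lt; apply: increasing_comp.
move: FG; rewrite /family_order.
destruct rF as [thF [hF sF cF]]; destruct rG as [thG [hG sG cG]].
case: pselect => [F0|nF]; first by rewrite F0 in Fs0.
case: pselect => //= nG FG.
have h0 : h fset0 = fset0 by rewrite -(pre0 id) hpre !pre0.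
have := @tree_rank_le _ _ h hext fset0 (extends_wf cG fset0); rewrite h0.
by move=> /(_ (extends_wf cF fset0)) GF'; apply: olt_irrefl (olt_ole_trans FG GF').
Qed.

(** * Plegma pairs and interlaced sequences *)

Lemma plegma_pairE s t : plegma_pair s t ->
  [/\ 0 < #|` s|, 0 < #|` t|,
      forall k, k < #|` s| -> k < #|` t| -> elt s k.+1 < elt t k.+1
    & forall k, k.+1 < #|` s| -> k < #|` t| -> elt t k.+1 < elt s k.+2].
Proof.
case=> ne lt lt'; split.
- by rewrite cardfs_gt0; exact: (ne ord0).
- by rewrite cardfs_gt0; exact: (ne (lift ord0 ord0)).
- move=> k ks kt; have kst : 0 < k.+1 <= minn #|` s| #|` t| by lia.
  exact: (lt ord0 (lift ord0 ord0) _ isT kst).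
- move=> k ks kt; have kts : 0 < k.+1 <= minn #|` t| (#|` s| - 1) by lia.
  exact: (lt' (lift ord0 ord0) ord0 _ kts).
Qed.

Lemma plegma_card (F : set {fset nat}) s t : regular_thin F -> F s -> F t ->
  plegma_pair s t -> #|` s| <= #|` t|.
Proof.
move=> rF; have [x ix ->] := fset_preT s; have [y iy ->] := fset_preT t.
move: #|` s| #|` t| => m n Fs Ft /plegma_pairE[_ _ xy _].
rewrite !card_pre // in xy *.
apply: (thin_spread rF ix iy (sub_hat Fs) Ft) => i i_n i_m.
by have := xy i i_m i_n; rewrite !elt_pre //=; lia.
Qed.

(** One sequence codes a pair of interlaced ones, so that colouring such pairs amounts to colouring
    single sequences. *)
Definition evens (x : nat -> nat) : nat -> nat := x \o double.
Definition odds (x : nat -> nat) : nat -> nat := x \o (fun i => i.*2.+1).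

Lemma evens_increasing x : increasing x -> increasing (evens x).
Proof. by move=> ix i j ij; apply: ix; lia. Qed.

Lemma odds_increasing x : increasing x -> increasing (odds x).
Proof. by move=> ix i j ij; apply: ix; lia. Qed.

Definition interleave (x y : nat -> nat) : nat -> nat :=
  fun i => if odd i then y i./2 else x i./2.

Lemma evens_interleave x y : evens (interleave x y) = x.
Proof. by apply/funext => i; rewrite /evens /interleave /= odd_double doubleK. Qed.

Lemma odds_interleave x y : odds (interleave x y) = y.
Proof. by apply/funext => i; rewrite /odds /interleave /= odd_double uphalf_double. Qed.

Lemma interleave_increasing x y : (forall i, x i < y i < x i.+1) ->
  increasing (interleave x y).
Proof.
move=> xy; apply: increasingS => i; rewrite /interleave /= uphalf_half.
by case: (odd i) => /=; have /andP[] := xy i./2.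
Qed.

(** * Images of plegma pairs under [phi] *)

Section Plegma.
Variables (F G : set {fset nat}) (rF : regular_thin F) (rG : regular_thin G).
Variables (phi : {fset nat} -> {fset nat}) (phiP : forall s, F s -> G (phi s)).

(* Junk unless an initial segment of [x] lies in [F]; by thinness there is at most one. *)
Definition phi_initial (x : nat -> nat) : {fset nat} :=
  phi (pre x (xget 0 [set n | F (pre x n)])).

Lemma phi_initialE x n : increasing x -> F (pre x n) -> phi_initial x = phi (pre x n).
Proof.
move=> ix Fx; congr (phi (pre x _)).
by apply: (thin_pre_eq rF ix _ Fx); exact: (@xgetPex _ 0 [set n | F (pre x n)] (ex_intro _ n Fx)).
Qed.

Variables (e : nat -> nat) (ie : increasing e).
Hypothesis eF : forall k, increasing k -> exists n, F (pre (e \o k) n).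

Lemma phi_initial_local k : increasing k -> exists n, forall k', increasing k' ->
  (forall i, i < n -> k' i = k i) -> phi_initial (e \o k') = phi_initial (e \o k).
Proof.
move=> ik; have [n Fn] := eF ik; exists n => k' ik' k'k.
have kk : pre (e \o k') n = pre (e \o k) n by apply: eq_pre => i /k'k /= ->.
by rewrite !(@phi_initialE _ n) ?kk //; apply: increasing_comp.
Qed.

Lemma interlaced_continuous (c : {fset nat} -> {fset nat} -> Prop) :
  continuous_on_increasing
    (fun k => c (phi_initial (e \o evens k)) (phi_initial (e \o odds k))).
Proof.
move=> k ik; have [m mP] := phi_initial_local (evens_increasing ik).
have [n nP] := phi_initial_local (odds_increasing ik).
exists (m + n).*2 => k' ik' k'k.
rewrite (mP _ (evens_increasing ik')) ?(nP _ (odds_increasing ik')) // => i i_n.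
  by apply: (k'k i.*2.+1); lia.
by apply: (k'k i.*2); lia.
Qed.

Lemma phi_initialG k : increasing k -> G (phi_initial (e \o k)).
Proof.
move=> ik; have [n Fn] := eF ik; rewrite (phi_initialE _ Fn); first exact: phiP.
exact: increasing_comp.
Qed.

Lemma not_plegma_reversing : ~ (forall k, increasing k ->
  plegma_pair (phi_initial (e \o odds k)) (phi_initial (e \o evens k))).
Proof.
(* Each [k n] interlaces with [k n.+1], which gives an infinite plegma path. *)
move=> rev; pose k n i := i.*2 + n.
pose m n := elt (phi_initial (e \o k n)) 1.
have dec n : m n.+1 < m n.
  have : increasing (interleave (k n) (k n.+1)).
    by apply: interleave_increasing => i; rewrite /k; lia.
  move/rev; rewrite evens_interleave odds_interleave.
  by case/plegma_pairE => s0 t0 /(_ 0 s0 t0).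
have bound n : m n + n <= m 0 by elim: n => [|n IH]; last have := dec n; lia.
by have := bound (m 0).+1; lia.
Qed.

Section Preserving.
Hypothesis pres : forall k, increasing k ->
  plegma_pair (phi_initial (e \o evens k)) (phi_initial (e \o odds k)).

Let size_phi k := #|` phi_initial (e \o k)|.
Let elt_phi k j := elt (phi_initial (e \o k)) j.+1.

(** The gaps leave room for another sequence to interlace with [k]. *)
Let gapped (k : nat -> nat) := forall i, (k i).+1 < k i.+1.

Lemma gapped_increasing k : gapped k -> increasing k.
Proof. by move=> gk; apply: increasingS => i; apply: ltnW; apply: gk. Qed.

Lemma preserving_step k k' : increasing k -> increasing k' -> (forall i, k i < k' i < k i.+1) ->
  [/\ 0 < size_phi k, size_phi k <= size_phi k',
      forall j, j < size_phi k -> elt_phi k j < elt_phi k' j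
    & forall j, j.+1 < size_phi k -> elt_phi k' j < elt_phi k j.+1].
Proof.
move=> ik ik' kk'; have := pres (interleave_increasing kk').
rewrite evens_interleave odds_interleave => pl.
have le := plegma_card rG (phi_initialG ik) (phi_initialG ik') pl.
have [s0 t0 lt lt'] := plegma_pairE pl; split=> // j js.
  by apply: lt => //; apply: leq_trans js le.
by apply: lt' => //; apply: leq_trans (ltnW js) le.
Qed.

(* Both bounds walk along plegma paths: shifting [k] down by one moves the
   minimum of the image down, while dropping the first entry of [k] and
   shifting down sends the [j.+1]-st element of the image below the [j]-th. *)
Lemma preserving_min n k : gapped k -> n <= k 0 -> n <= elt_phi k 0.
Proof.
elim: n k => // n IH k gk nk; pose k' := predn \o k.
have k0 i : 0 < k i.
  by case: i => [|i]; [lia|have := gk i; lia].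
have gk' : gapped k' by move=> i; rewrite /k' /=; have := gk i; have := k0 i; lia.
have kk' i : k' i < k i < k' i.+1.
  by rewrite /k' /=; have := gk i; have := k0 i; lia.
have [s0 _ lt _] := preserving_step (gapped_increasing gk') (gapped_increasing gk) kk'.
apply: leq_ltn_trans (lt 0 s0); apply: IH => //.
by rewrite /k' /=; lia.
Qed.

Lemma preserving_elt j k : gapped k -> j < size_phi k -> k j <= elt_phi k j + j.
Proof.
elim: j k => [|j IH] k gk js; first by rewrite addn0; apply: preserving_min.
pose k' i := (k i.+1).-1.
have gk' : gapped k' by move=> i; rewrite /k'; have := gk i.+1; have := gk i; lia.
have kk' i : k i < k' i < k i.+1 by rewrite /k'; have := gk i; lia.
have [_ le _ lt] := preserving_step (gapped_increasing gk) (gapped_increasing gk') kk'.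
by have := IH k' gk' (leq_trans (ltnW js) le); have := lt j js; rewrite /k'; lia.
Qed.

Lemma not_plegma_preserving : F !=set0 ->
  order_lt (family_order rF) (family_order rG) -> False.
Proof.
move=> F0 FG; have i2 : increasing double by move=> i j ij; lia.
(* Doubling creates the gaps: [x] is compared with [e \o double \o x], and [double \o x] is
   gapped. *)
have [x [n [ix Gx nFx]]] := order_lt_hat FG F0 (increasing_comp ie i2).
have g2 y : increasing y -> gapped (double \o y).
  by move=> iy i /=; have := iy i i.+1 (ltnSn i); lia.
have ik := increasing_comp i2 ix.
set k := double \o x in ik; have [d Fd] := eF ik.
have dn : d < n.
  rewrite ltnNge; apply/negP => nd; apply: nFx.
  apply: (hat_pre_le rF _ nd (sub_hat Fd)).
  by apply: increasing_comp.
(* Otherwise [2 * x i <= a i + i] and [i <= x i] would give [x i <= a i] along the whole image, and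
   [thin_spread] would force [n <= d]. *)
have ds : d < size_phi k.
  have Gphi := phi_initialG ik.
  rewrite ltnNge; apply/negP => sd; have [a ia phia] := fset_preT (phi_initial (e \o k)).
  suff : n <= d by lia.
  apply: leq_trans sd; rewrite /size_phi; rewrite phia in Gphi.
  apply: (thin_spread rG ix ia Gx Gphi) => i i_s i_n.
  have := preserving_elt (g2 _ ix) i_s.
  rewrite /elt_phi -/k phia elt_pre //.
  by have := increasing_ge i ix; rewrite /k /=; lia.
(* [y] keeps the [d] entries that determine the image, but [y d] exceeds the image's element of
   index [d], counted from 0. *)
have [//|i j /andP[ij _]|i _|iy _] := @splice_refines x d id (elt_phi k d).+1.
- exact: ix.
- by exists (x i).
set y := splice x d id _ in iy.
have yphi : phi_initial (e \o (double \o y)) = phi_initial (e \o k).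
  have yk : pre (e \o (double \o y)) d = pre (e \o k) d.
    by apply: eq_pre => i i_d; rewrite /= /y splice_lt.
  by rewrite !(@phi_initialE _ d) ?yk //; do !apply: increasing_comp => //.
(* The bound [2 * y d <= elt_phi k d + d] contradicts [elt_phi k d < y d] and [d <= y d]. *)
have := @preserving_elt d (double \o y) (g2 _ iy).
rewrite /size_phi /elt_phi yphi => /(_ ds) /=.
have : (elt_phi k d).+1 <= y d by apply: splice_ge.
by rewrite /elt_phi; have := increasing_ge d iy; lia.
Qed.

End Preserving.

(** A plegma pair among the odd-indexed values of [e] extends to two interlaced infinite sequences,
    the even indices being free for the continuation of the first set. *)
Lemma plegma_from_interlaced (c : {fset nat} -> {fset nat} -> Prop) :
  (forall k, increasing k ->
    ~ c (phi_initial (e \o evens k)) (phi_initial (e \o odds k))) ->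
  forall s t, F s -> F t -> [set` s] `<=` range (odds e) ->
    [set` t] `<=` range (odds e) -> plegma_pair s t -> ~ c (phi s) (phi t).
Proof.
move=> nc s t; have io := odds_increasing ie.
move=> Fs Ft sL tL pl.
have [k /sL[i _ <-]|x [ix xe] sx] := @fset_pre (odds e) s io; first by exists i.
have [k /tL[i _ <-]|y [iy ye] ty] := @fset_pre (odds e) t io; first by exists i.
have /choice[a ax] := xe; have /choice[b yb] := ye.
have le := plegma_card rF Fs Ft pl.
have [_ _ lt lt'] := plegma_pairE pl.
set m := #|` s| in sx le lt lt'; set n := #|` t| in ty le lt lt'.
have eltx i : i < m -> elt s i.+1 = x i by move=> im; rewrite sx elt_pre.
have elty i : i < n -> elt t i.+1 = y i by move=> i_n; rewrite ty elt_pre.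
have ltE i j : (odds e i < odds e j) = (i < j) by apply: increasing_ltn.
have ib : increasing b by move=> i j /iy; rewrite !yb ltE.
(* Past the end of [s], the even index just below [v i] keeps the interlacing. Before it, [m <= n]
   makes the plegma inequalities available. *)
pose u i := if i < m then (a i).*2.+1 else (b i).*2.
pose v i := (b i).*2.+1.
have iuv : increasing (interleave u v).
  apply: interleave_increasing => i; rewrite /u /v; apply/andP; split.
    case: (ltnP i m) => im; last by lia.
    have i_n := leq_trans im le.
    by have := lt i im i_n; rewrite eltx ?elty // ax yb ltE; lia.
  case: (ltnP i.+1 m) => im; last by have := ib i i.+1 (ltnSn i); lia.
  have i_n := leq_trans (ltnW im) le.
  by have := lt' i im i_n; rewrite eltx ?elty // ax yb ltE; lia.
have := nc _ iuv; rewrite evens_interleave odds_interleave.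
have iu : increasing u by rewrite -(evens_interleave u v); apply: evens_increasing.
have iv : increasing v by rewrite -(odds_interleave u v); apply: odds_increasing.
have us : pre (e \o u) m = s.
  by rewrite sx; apply: eq_pre => i im /=; rewrite /u im ax.
have vt : pre (e \o v) n = t.
  by rewrite ty; apply: eq_pre => i im /=; rewrite /v yb.
rewrite (@phi_initialE _ m) ?us //; last exact: increasing_comp.
by rewrite (@phi_initialE _ n) ?vt //; apply: increasing_comp.
Qed.

End Plegma.

(** * Infinite sets of naturals and the conclusion *)

Lemma infinite_enumeration (M : set nat) : infinite_set M ->
  exists2 e, increasing e & range e `<=` M.
Proof.
move=> iM; have [|r ir Mr] := @unbounded_subsequence M; last first.
  by exists r => // _ [i _ <-].
move=> n; apply: contrapT => h; apply: iM; apply: (@sub_finite_set _ _ `I_n) => [m Mm|].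
  by rewrite /= ltnNge; apply/negP => nm; apply: h; exists m.
exact: finite_II.
Qed.

Lemma increasing_infinite e : increasing e -> infinite_set (range e).
Proof.
move=> ie; apply/infinite_set_fsetP => n; exists (pre e n); last by rewrite card_pre.
by move=> k /=; rewrite mem_pre => /mapP[i _ ->]; exists i.
Qed.

Theorem theorem0p6 (F G : set {fset nat})
    (hF : family_on posN F) (hG : family_on posN G)
    (rF : regular_thin F) (rG : regular_thin G)
    (hFG : order_lt (family_order rF) (family_order rG))
    (phi : {fun F >-> G})
    (M : set nat) (hM : M `<=` posN) (infM : infinite_set M) :
  exists L : set nat,
    [/\ L `<=` M, infinite_set L &
      forall s1 s2 : {fset nat},
        family_restrict F L s1 -> family_restrict F L s2 -> plegma_pair s1 s2 ->
        ~ plegma_pair (phi s1) (phi s2) /\ ~ plegma_pair (phi s2) (phi s1)].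
Proof.
have [F0|/set0P F0] := eqVneq F set0.
  by exists M; split=> // s1 s2 []; rewrite {1}F0.
have phiP s : F s -> G (phi s) by apply: funS.
have [m im mM] := infinite_enumeration infM.
have [e [ie em] eF] := regular_thin_very_large rF F0 im.
have {}eF k : increasing k -> exists n, F (pre (e \o k) n).
  by move=> ik; apply: eF; apply: refines_comp.
have iid : increasing id by [].
(* The colourings are on index sequences, to be composed with [e]. The second application takes
   place inside [k1], so [k2] is homogeneous for both orders. *)
have [k1 [ik1 _] fwd] := ramsey (interlaced_continuous rF phi ie eF plegma_pair) iid.
have [k2 k21 bwd] :=
  ramsey (interlaced_continuous rF phi ie eF (fun s t => plegma_pair t s)) ik1.
have ik2 := k21.1; have ie2 := increasing_comp ie ik2.
have eF2 k : increasing k -> exists n, F (pre ((e \o k2) \o k) n).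
  by move=> ik; apply: eF; apply: increasing_comp.
have nfwd k : increasing k -> ~ plegma_pair
    (phi_initial F phi ((e \o k2) \o evens k)) (phi_initial F phi ((e \o k2) \o odds k)).
  move=> ik; case: fwd => fwd; last first.
    by apply: (fwd (k2 \o k)); apply: refines_trans k21; apply: refines_comp.
  case: (@not_plegma_preserving _ _ rF rG phi phiP (e \o k2) ie2 eF2) => // l il.
  by apply: (fwd (k2 \o l)); apply: refines_trans k21; apply: refines_comp.
have nbwd k : increasing k -> ~ plegma_pair
    (phi_initial F phi ((e \o k2) \o odds k)) (phi_initial F phi ((e \o k2) \o evens k)).
  move=> ik; case: bwd => bwd; last by apply: (bwd (k2 \o k)); apply: refines_comp.
  case: (@not_plegma_reversing F phi (e \o k2)) => l il.
  by apply: (bwd (k2 \o l)); apply: refines_comp.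
(* The odd indices leave the room that [plegma_from_interlaced] uses. *)
exists (range (odds (e \o k2))); split.
- move=> _ [i _ <-]; apply: mM; have [j ej] := em (k2 i.*2.+1).
  by exists j => //; rewrite -ej.
- exact/increasing_infinite/odds_increasing.
move=> s1 s2 [Fs1 sL1] [Fs2 sL2] pl; split.
  exact: (plegma_from_interlaced rF ie2 nfwd) pl.
exact: (plegma_from_interlaced (c := fun s t => plegma_pair t s) rF ie2 nbwd) pl.
Qed.
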